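(* Let $I=(n,m,X_1,\ldots,X_m,\tau)$ be an instance of WPPSG and let $\Pi_0,\Pi'_1,\Pi_1,\ldots,\Pi'_m,\Pi_m$ be the sets computed by the procedure REDUCE-EXPAND on input $X_1,\ldots,X_m$. Then $I$ is nice if and only if $\Pi_m\neq\emptyset$.
   Context: $\mathcal{S}_n$ is the symmetric group on $[n]=\{1,\ldots,n\}$, with $i\sigma$ the image of $i$ and products composed left to right; $X\sigma=\{i\sigma:i\in X\}$; $\mathcal{S}_X$ is the subgroup fixing every element outside $X$. REDUCE-EXPAND: set $X_0=[n]$, $\Pi_0=\mathcal{S}_n$; for $j=1,\ldots,m$: $\Pi'_j=\{\pi\sigma:\pi\in\Pi_{j-1},\ \sigma\in\mathcal{S}_{X_{j-1}\pi}\}$ and $\Pi_j=\{\pi\in\Pi'_j: X_j\pi\text{ is a set of consecutive integers}\}$. An instance of WPPSG is $I=(n,m,X_1,\ldots,X_m,\tau)$ with $X_j\subseteq[n]$, $\tau\in\mathcal{S}_n$; WPPSG$_0$ consists of instances in which every $X_j$ is a set of consecutive integers. For $\pi\in\mathcal{S}_n$, $I^\pi=(n,m,X_1\pi,\ldots,X_m\pi,\pi^{-1}\tau\pi)$. For $j'\in[m]$ and $\varphi\in\mathcal{S}_{X_{j'}}$, $I[j',\varphi]=(n,m,X'_1,\ldots,X'_m,\tau\varphi)$ with $X'_j=X_j$ for $j\le j'$ and $X'_j=X_j\varphi$ for $j>j'$; $I[0,\varphi]=I^\varphi$. A valid elementary transformation of $I$ is any $I[j,\varphi]$ with $j\in\{0,\ldots,m\}$,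 $\varphi\in\mathcal{S}_{X_j}$ (sets of the current instance). $I$ is nice if some instance of WPPSG$_0$ can be obtained from $I$ by a finite chain of valid elementary transformations. *)

(* Defs.v *)
From mathcomp Require Import all_boot all_fingroup.

Set Implicit Arguments.
Unset Strict Implicit.
Unset Printing Implicit Defensive.

Local Open Scope group_scope.

(* [n] = {1, ..., n} is represented by 'I_n = {0, ..., n - 1}. *)

(* The empty set (a = b) counts as a set of consecutive integers. *)
Definition consecutive n (A : {set 'I_n}) : bool :=
  [exists a : 'I_n.+1, exists b : 'I_n.+1, A == [set i : 'I_n | a <= i < b]].

(* X_j for 0 <= j <= m, where X_0 = [n] and X_j is entry j - 1 of the tuple. *)
Definition Xset n m (Xs : m.-tuple {set 'I_n}) (j : nat) : {set 'I_n} :=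
  if j is k.+1 then nth set0 Xs k else setT.

(* Products of permutations in MathComp are composed left to right, and
   Sym X is the set of permutations fixing every element outside X. *)
Definition expand n (X : {set 'I_n}) (Pi : {set 'S_n}) : {set 'S_n} :=
  [set pi * sigma | pi in Pi, sigma in Sym (pi @: X)].

Definition reduce n (X : {set 'I_n}) (Pi : {set 'S_n}) : {set 'S_n} :=
  [set pi in Pi | consecutive (pi @: X)].

(* The set Pi_j; the intermediate set Pi'_(j+1) is expand X_j Pi_j. *)
Fixpoint reduce_expand n m (Xs : m.-tuple {set 'I_n}) (j : nat) : {set 'S_n} :=
  if j is k.+1 then
    reduce (Xset Xs k.+1) (expand (Xset Xs k) (reduce_expand Xs k))
  else setT.

Record instance (n m : nat) := Instance {
  isets : m.-tuple {set 'I_n};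
  itau : 'S_n
}.

Definition WPPSG0 n m (I : instance n m) : Prop :=
  forall j, 1 <= j <= m -> consecutive (Xset (isets I) j).

(* tau ^ pi is MathComp's conjugate pi^-1 * tau * pi. *)
Definition iconj n m (I : instance n m) (pi : 'S_n) : instance n m :=
  Instance [tuple of [seq pi @: X | X : {set 'I_n} <- isets I]] (itau I ^ pi).

(* I[j, phi]; the tuple entry of index i is X_(i+1), which is left unchanged
   if and only if i + 1 <= j. *)
Definition elem_transf n m (I : instance n m) (j : nat) (phi : 'S_n) :
    instance n m :=
  if j is 0 then iconj I phi else
  Instance [tuple (if i.+1 <= j then tnth (isets I) i
                   else phi @: tnth (isets I) i) | i < m]
           (itau I * phi).

Inductive obtainable n m (I : instance n m) : instance n m -> Prop :=
| obtainable_refl : obtainable I I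
| obtainable_step (J : instance n m) (j : nat) (phi : 'S_n) :
    obtainable I J -> j <= m -> phi \in Sym (Xset (isets J) j) ->
    obtainable I (elem_transf J j phi).

Definition nice n m (I : instance n m) : Prop :=
  exists2 J : instance n m, obtainable I J & WPPSG0 J.

(* Main.v *)
Require Import Defs.
From mathcomp Require Import all_boot all_fingroup.

Set Implicit Arguments.
Unset Strict Implicit.
Unset Printing Implicit Defensive.

Local Open Scope group_scope.

(** Both sides are described by chains of permutations [q_0, q_1, ...] such
    that [q_j^-1 q_(j+1)] is supported on [X_j q_j].  The set [Pi_k] consists
    of the last terms [q_k] of the chains for which every [X_j q_j] is
    consecutive.  A valid elementary transformation at [j] multiplies [q_i] by
    [phi] for [i > j], so every obtainable instance has sets [X_j q_j] for some
    chain; conversely a chain is realised by conjugating by [q_0] and then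
    applying [q_j^-1 q_(j+1)] at [j = 0, 1, ...] successively. *)

(** The points moved by [s ^ p] are the images under [p] of those moved by [s]. *)
Lemma mem_SymJ n (X : {set 'I_n}) (s p : 'S_n) :
  s \in Sym X -> s ^ p \in Sym (p @: X).
Proof.
rewrite !inE => /subsetP sX; apply/subsetP => x; rewrite inE => sx.
rewrite -[x](permKV p); apply/imset_f/sX; rewrite inE.
apply: contra sx => /eqP sx.
by rewrite /conjg !permM sx permKV.
Qed.

Lemma imset_permM n (X : {set 'I_n}) (p q : 'S_n) :
  (p * q) @: X = q @: (p @: X).
Proof. by rewrite -imset_comp; apply: eq_imset => x; rewrite permM. Qed.

Lemma imset_perm1 n (X : {set 'I_n}) : (1 : 'S_n) @: X = X.
Proof. by rewrite -[RHS]imset_id; apply: eq_imset => x; rewrite perm1. Qed.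

Lemma imset_permT n (p : 'S_n) : p @: [set: 'I_n] = setT.
Proof.
apply/eqP; rewrite eqEcard subsetT card_imset ?leqnn //; exact: perm_inj.
Qed.

Lemma mem_SymT n (s : 'S_n) : s \in Sym [set: 'I_n].
Proof. by rewrite inE; apply/subsetP => x _; rewrite inE. Qed.

Section Chains.

Variables (n m : nat).
Implicit Types (Xs : m.-tuple {set 'I_n}) (q : nat -> 'S_n) (I J : instance n m).

Definition chain Xs k q :=
  forall j, j < k -> (q j)^-1 * q j.+1 \in Sym (q j @: Xset Xs j).

Lemma mem_reduce_expandP Xs k (p : 'S_n) :
  p \in reduce_expand Xs k <->
  exists q, [/\ q k = p, chain Xs k q
    & forall j, 1 <= j <= k -> consecutive (q j @: Xset Xs j)].
Proof.
elim: k p => [|k IHk] p.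
  split=> [_|_]; last by rewrite inE.
  by exists (fun=> p); split=> // -[].
rewrite [reduce_expand _ _]/=; split; rewrite inE.
  case/andP => /imset2P[r s /IHk[q [qk qch qcons]] sS ->] cons_p.
  (* The old chain ends at [q k = r], so appending [r * s] creates the link [s]; values past [k.+1]
     are never inspected. *)
  exists (fun j => if j <= k then q j else r * s); split; first by rewrite ltnn.
    move=> j; rewrite ltnS => lejk; rewrite lejk.
    case: (ltngtP j k) lejk => // [ltjk|->] _; last by rewrite qk mulKg.
    exact: qch.
  move=> j /andP[j1 lejk1]; case: leqP => [lejk|ltkj]; first by rewrite qcons ?j1.
  by have -> : j = k.+1 by apply/eqP; rewrite eqn_leq lejk1.
case=> q [<- qch qcons]; rewrite qcons ?leqnn // andbT.
(* The last link of the chain serves as the factor [sigma] in [expand]. *)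
rewrite -(mulKVg (q k) (q k.+1)); apply: imset2_f; last exact: qch.
apply/IHk; exists q; split=> // [j ltjk|j /andP[j1 lejk]].
  exact/qch/ltnW.
by rewrite qcons // j1 ltnW.
Qed.

Lemma Xset_iconj I (p : 'S_n) j : Xset (isets (iconj I p)) j = p @: Xset (isets I) j.
Proof.
case: j => [|j] /=; first by rewrite imset_permT.
case: (ltnP j m) => jm; first by rewrite (nth_map set0) ?size_tuple.
by rewrite !nth_default ?size_map ?size_tuple // imset0.
Qed.

(** One formula covers conjugation too: for [k = 0] the condition never holds, so every set is
    moved. At [j = 0] the set is [setT], stable under [p]. *)
Lemma Xset_elem_transf I k (p : 'S_n) j :
  Xset (isets (elem_transf I k p)) j =
  if (0 < j) && (j <= k) then Xset (isets I) j else p @: Xset (isets I) j.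
Proof.
case: k => [|k]; first by rewrite Xset_iconj; case: j.
case: j => [|j]; first by rewrite /= imset_permT.
rewrite /Xset ltnS; case: (ltnP j m) => jm.
  have := tnth_mktuple (fun i : 'I_m => if i < k.+1 then tnth (isets I) i
                   else p @: tnth (isets I) i) (Ordinal jm).
  by rewrite !(tnth_nth set0).
by rewrite !nth_default ?imset0 ?if_same ?size_tuple.
Qed.

Lemma obtainable_chain I J : obtainable I J ->
  exists2 q, chain (isets I) m q
    & forall j, Xset (isets J) j = q j @: Xset (isets I) j.
Proof.
elim=> [|{}J k p _ [q qch qJ] lekm pS].
  exists (fun=> 1) => [j _|j]; last by rewrite imset_perm1.
  by rewrite mulVg group1.
exists (fun j => if (0 < j) && (j <= k) then q j else q j * p) => [j ltjm|j].
  case: (posnP j) => [->|j0]; first by rewrite imset_permT mem_SymT.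
  (* Links before [k] are unchanged and later ones are conjugated by [p] along with their supports.
     The link at [k] gains the factor [p], which lies in the same group because the current set of
     index [k] is its image under [q k]. *)
  rewrite /=; case: (ltngtP j k) => [ltjk|ltkj|ejk].
  - exact: qch.
  - rewrite imset_permM invMg -mulgA (mulgA _^-1 _ p).
    exact/mem_SymJ/qch.
  - by rewrite mulgA groupM ?qch // ejk -qJ.
by rewrite Xset_elem_transf; case: ifP => _; rewrite qJ ?imset_permM.
Qed.

(** After the first [k] links are applied, sets of index at most [k] are in final position, while
    later ones have only been carried along to [q k]. *)
Lemma chain_obtainable I k q : k <= m -> chain (isets I) k q ->
  exists2 J, obtainable I J
    & forall j, 0 < j -> Xset (isets J) j = q (minn j k) @: Xset (isets I) j.
Proof.
elim: k => [|k IHk] lekm qch.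
  exists (elem_transf I 0 (q 0)) => [|j _].
    by apply: obtainable_step; [exact: obtainable_refl | | exact: mem_SymT].
  by rewrite Xset_iconj minn0.
have [|J IJ JX] := IHk (ltnW lekm); first by move=> j ltjk; exact/qch/ltnW.
exists (elem_transf J k ((q k)^-1 * q k.+1)).
  apply: obtainable_step => //; first exact: ltnW.
  case: (posnP k) => [->|k0]; first exact: mem_SymT.
  by rewrite JX // minnn qch.
move=> j j0; rewrite Xset_elem_transf j0 JX //=.
case: (leqP j k) => [lejk|ltkj].
  by rewrite (minn_idPl (leqW lejk)).
by rewrite (minn_idPr ltkj) -imset_permM mulKVg.
Qed.

End Chains.

Theorem theorem5p5 (n m : nat) (I : instance n m) :
  nice I <-> reduce_expand (isets I) m <> set0.
Proof.
split=> [[J /obtainable_chain[q qch qJ] J0] |].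
  apply/eqP/set0Pn; exists (q m); apply/mem_reduce_expandP.
  by exists q; split=> // j jm; rewrite -qJ J0.
move/eqP/set0Pn => [p /mem_reduce_expandP[q [_ qch qcons]]].
have [J IJ JX] := chain_obtainable (leqnn m) qch.
exists J => // j jm; have /andP[j0 lejm] := jm.
by rewrite JX // (minn_idPl lejm) qcons.
Qed.
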